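(* Let $N \ge 1$ and $D \ge 1$, and for each $i = 1, \dots, N$ let $\mathbf{P}_i = \{x \in \mathbb{R}^D \mid A_i x \le b_i\}$ be a nonempty polytope, where $A_i$ is a real matrix with $m_i$ rows and $D$ columns and $b_i \in \mathbb{R}^{m_i}$. Let $A' \in \mathbb{R}^{c \times D}$ be the matrix whose rows $a_1^T, \dots, a_c^T$ are the distinct rows that occur among the matrices $A_1, \dots, A_N$, each listed exactly once. For each $i = 1, \dots, N$ let $b_i' \in \mathbb{R}^c$ be the vector whose $j$-th entry is the optimal value of the linear program $$b_i'(j) = \max\{a_j^T x \mid A_i x \le b_i\}, \qquad j = 1, \dots, c.$$ Then the polytope $\left\{x \in \mathbb{R}^D \;\middle|\; A' x \le \sum_{i=1}^N b_i'\right\}$ is an outer approximation of the Minkowski sum of the $N$ polytopes, i.e. it contains $\{x_1 + \dots + x_N \mid x_i \in \mathbf{P}_i \text{ for } i = 1, \dots, N\}$.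
   Context: Vector inequalities are componentwise. A polytope is a convex set in $\mathbb{R}^D$ given by finitely many linear inequalities; all polytopes are assumed to be closed and bounded (compact). A set $\mathbf{Q}$ is an outer approximation of a set $\mathbf{S}$ if $\mathbf{S} \subseteq \mathbf{Q}$. *)

(* Defs.v *)
From mathcomp Require Import all_boot all_order all_algebra.
From mathcomp Require Import all_classical all_reals all_analysis.
Set Implicit Arguments.
Unset Strict Implicit.
Unset Printing Implicit Defensive.
Import Order.TTheory GRing.Theory Num.Theory.
Import numFieldNormedType.Exports.
Local Open Scope classical_set_scope.
Local Open Scope ring_scope.

Definition vec_le (R : realType) (n : nat) (u v : 'cV[R]_n) : Prop :=
  forall k : 'I_n, u k 0 <= v k 0.

Definition polyhedron (R : realType) (m D : nat) (A : 'M[R]_(m, D))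
    (b : 'cV[R]_m) : set 'cV[R]_D :=
  [set x | vec_le (A *m x) b].

(* Convexity is automatic for a set of this form. *)
Definition is_polytope (R : realType) (D : nat) (P : set 'cV[R]_D) : Prop :=
  (exists (m : nat) (A : 'M[R]_(m, D)) (b : 'cV[R]_m), P = polyhedron A b) /\
  compact P.

Definition is_max (R : realType) (V : set R) (v : R) : Prop :=
  V v /\ ubound V v.

(* If the maximum is not attained the value is 0 by convention; this cannot
   happen when the feasible set is nonempty and compact. *)
Definition lp_value (R : realType) (m D : nat) (a : 'rV[R]_D)
    (A : 'M[R]_(m, D)) (b : 'cV[R]_m) : R :=
  xget 0 [set v | is_max [set (a *m x) 0 0 | x in polyhedron A b] v].

(* The order in which the distinct rows are listed is left arbitrary. *)
Definition lists_distinct_rows (R : realType) (N D c : nat) (m : 'I_N -> nat)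
    (A : forall i : 'I_N, 'M[R]_(m i, D)) (A' : 'M[R]_(c, D)) : Prop :=
  injective (fun j : 'I_c => row j A') /\
  (forall a : 'rV[R]_D,
     (exists j : 'I_c, row j A' = a) <->
     (exists (i : 'I_N) (k : 'I_(m i)), row k (A i) = a)).

Definition minkowski_sum (R : realType) (N D : nat)
    (P : 'I_N -> set 'cV[R]_D) : set 'cV[R]_D :=
  [set \sum_(i < N) x i | x in [set x : 'I_N -> 'cV[R]_D |
                                 forall i, P i (x i)]].

Definition outer_approximation (R : realType) (D : nat)
    (Q S : set 'cV[R]_D) : Prop := S `<=` Q.

(* Main.v *)
Require Import Defs.
From mathcomp Require Import all_boot all_order all_algebra.
From mathcomp Require Import all_classical all_reals all_analysis.
Import Order.TTheory GRing.Theory Num.Theory.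
Import numFieldNormedType.Exports.
Local Open Scope classical_set_scope.
Local Open Scope ring_scope.

(** The inclusion is immediate once each linear program attains its maximum, as
    it does on a nonempty compact set: a point [x i] of the [i]-th polytope then
    satisfies [a *m x i <= lp_value a (A i) (b i)] for every row [a]
    ([le_lp_value]), and these inequalities add up over [i].

    The new set must moreover be compact, whatever its right-hand side turns out
    to be. What decides this is the recession cone [A' *m d <= 0], which does not
    see the right-hand side: a polyhedron whose recession cone is trivial is
    compact ([polyhedron_compact]). Since the rows of [A'] include those of
    the matrix of one of the given polytopes, say the first, the recession cone of
    the new set lies in the recession cone of that polytope, which is trivial
    because the polytope is nonempty and bounded
    ([bounded_polyhedron_recession]). *)

Lemma sum_continuous (R : realType) (T : topologicalType) (n : nat)
    (F : 'I_n -> T -> R) :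
  (forall k, continuous (F k)) -> continuous (fun x => \sum_k F k x).
Proof.
move=> Fcont; apply: (continuous_big (op := +%R)) => //.
exact: (@add_continuous R^o).
Qed.

Lemma mulmx_coord_continuous (R : realType) (m D : nat) (A : 'M[R]_(m, D))
    (k : 'I_m) : continuous (fun x : 'cV[R]_D => (A *m x) k 0).
Proof.
under [X in continuous X]funext => x do rewrite mxE.
refine (@sum_continuous R 'cV[R]_D _ (fun j x => A k j * x j 0) _) => j x.
apply: (@continuousM R 'cV[R]_D (cst (A k j)) (fun x => x j 0)).
  exact: cst_continuous.
exact: coord_continuous.
Qed.

Lemma polyhedron_closed (R : realType) (m D : nat) (A : 'M[R]_(m, D))
    (b : 'cV[R]_m) : closed (polyhedron A b).
Proof.
have -> : polyhedron A b =
    \bigcap_k (fun x => (A *m x) k 0) @^-1` [set y | y <= b k 0].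
  by apply/seteqP; split => x h k => [_|]; apply: h.
apply: closed_bigI => k _; apply: preimage_closed; last exact: closed_le.
by move=> x _; exact: mulmx_coord_continuous.
Qed.

Lemma trmx_continuous (R : realType) (m n : nat) :
  continuous (trmx : 'M[R]_(m, n) -> 'M[R]_(n, m)).
Proof.
move=> M s /nbhs_ballP[e /= e0 es]; apply/nbhs_ballP; exists e => //= N [_ MN].
by apply: es; split => // i j; rewrite !mxE.
Qed.

Lemma norm_trmx (R : realType) (m n : nat) (x : 'M[R]_(m, n)) :
  `|x^T| = `|x|.
Proof.
suff le_tr p q (y : 'M[R]_(p, q)) : `|y^T| <= `|y|.
  by apply/le_anti; rewrite le_tr -{1}[x]trmxK le_tr.
rewrite [leLHS]/Num.norm [leRHS]/Num.norm /= !mx_normrE.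
apply: bigmax_le => [|[i j] _]; first exact: bigmax_ge_id.
rewrite mxE; exact: (le_bigmax _ (fun ij : 'I_p * 'I_q => `|y ij.1 ij.2|) (j, i)).
Qed.

(** The Heine-Borel property passes from rows to columns, since transposition
    is continuous and preserves the maximum norm. *)
Lemma bounded_closed_compact_cV (R : realType) (D : nat) (S : set 'cV[R]_D) :
  bounded_set S -> closed S -> compact S.
Proof.
move=> [M [Mreal SM]] Scl.
have -> : S = trmx @` (trmx @^-1` S : set 'rV[R]_D).
  apply/seteqP; split => [x Sx|x [y Sy <-] //].
  by exists x^T; rewrite /= trmxK.
apply: continuous_compact.
  by apply: continuous_subspaceT => x; exact: trmx_continuous.
apply: bounded_closed_compact.
  by exists M; split => // N MN x Sx; rewrite /= -norm_trmx; exact: SM Sx.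
by apply: preimage_closed => // x _; exact: trmx_continuous.
Qed.

(** A direction along which no constraint increases keeps a feasible point
    feasible forever, so a nonzero one would make the polyhedron unbounded. *)
Lemma bounded_polyhedron_recession (R : realType) (m D : nat)
    (A : 'M[R]_(m, D)) (b : 'cV[R]_m) (d : 'cV[R]_D) :
  polyhedron A b !=set0 -> bounded_set (polyhedron A b) ->
  vec_le (A *m d) 0 -> d = 0.
Proof.
move=> [x Px] [M [_ PM]] Ad; apply: contrapT => /eqP d0.
have {}PM y : polyhedron A b y -> `|y| <= `|M| + 1.
  by apply: PM; rewrite (le_lt_trans (ler_norm M))// ltrDl.
have dgt0 : 0 < `|d| by rewrite normr_gt0.
(* far enough along the ray to exceed the bound, whatever the norm of x *)
pose t := (`|M| + 2 + `|x|) / `|d|.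
have t0 : 0 <= t by rewrite divr_ge0// !addr_ge0.
have /PM : polyhedron A b (x + t *: d).
  move=> k; rewrite mulmxDr -scalemxAr mxE [X in _ + X]mxE.
  rewrite -[leRHS]addr0; apply: lerD; first exact: Px.
  rewrite mulr_ge0_le0//.
  by have := Ad k; rewrite [leRHS]mxE.
apply/negP; rewrite -ltNge -(ltrD2r `|x|).
have tri : `|t *: d| <= `|x + t *: d| + `|x|.
  by have := ler_normB (x + t *: d) x; rewrite addrAC subrr add0r.
apply: lt_le_trans tri; rewrite normrZ ger0_norm// /t divfK ?gt_eqF//.
by rewrite ltrD2r ltrD2l ltr1n.
Qed.

(** Since [A *m x <= 0] only at the origin, the sum of the positive parts of the
    coordinates of [A *m x] is positive on the unit sphere, hence bounded below there by some positive [e]; being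
    homogeneous, it is at least [e * `|x|] everywhere, while on the polyhedron
    it is at most the sum of the positive parts of [s]. *)
Lemma polyhedron_compact (R : realType) (m D : nat)
    (A : 'M[R]_(m, D)) (s : 'cV[R]_m) :
  (forall d : 'cV[R]_D, vec_le (A *m d) 0 -> d = 0) ->
  compact (polyhedron A s).
Proof.
move=> A0; apply: bounded_closed_compact_cV; last exact: polyhedron_closed.
pose f (x : 'cV[R]_D) : R := \sum_(k < m) Num.max 0 ((A *m x) k 0).
pose S := [set x : 'cV[R]_D | `|x| = 1].
have fcont : continuous f.
  refine (@sum_continuous R 'cV[R]_D _ (fun k x => Num.max 0 ((A *m x) k 0)) _) => k x.
  apply: (@continuous_max _ _ (cst 0) (fun x : 'cV[R]_D => (A *m x) k 0)).
    exact: cst_continuous.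
  exact: mulmx_coord_continuous.
have f_ge0 x : 0 <= f x by apply: sumr_ge0 => k _; rewrite le_max lexx.
have fpos x : S x -> 0 < f x.
  move=> Sx; rewrite lt_neqAle f_ge0 andbT eq_sym; apply/negP => /eqP fx0.
  suff x0 : x = 0.
    by move: Sx; rewrite /S /= x0 normr0 => /esym/eqP; rewrite oner_eq0.
  apply: A0 => k; rewrite [leRHS]mxE.
  have /psumr_eq0P : forall k : 'I_m, true -> 0 <= Num.max 0 ((A *m x) k 0).
    by move=> j _; rewrite le_max lexx.
  by move=> /(_ fx0 k isT) maxk0; rewrite -[leRHS]maxk0 le_max lexx orbT.
have Scompact : compact S.
  apply: bounded_closed_compact_cV.
    by exists 1; split => // N N1 x /= ->; exact: ltW.
  have -> : S = (fun x : 'cV[R]_D => `|x|) @^-1` [set y | y = 1] by [].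
  apply: preimage_closed; last exact: closed_eq.
  by move=> x _; exact: norm_continuous.
have [e e0 ef] : exists2 e, 0 < e & forall x, S x -> e <= f x.
  (* the sphere is empty when D = 0 *)
  have [S0|/set0P Sn0] := eqVneq S set0.
    by exists 1 => // x; rewrite S0.
  have [] := compact_EVT_min Sn0 Scompact (f := f).
    by apply: continuous_subspaceT => x; exact: fcont.
  move=> c /set_mem Sc cmin; exists (f c); first exact: fpos.
  by move=> x Sx; apply: cmin; exact: mem_set.
have fZ t x : 0 <= t -> f (t *: x) = t * f x.
  move=> t0; rewrite mulr_sumr; apply: eq_bigr => k _.
  by rewrite -scalemxAr mxE maxr_pMr// mulr0.
have fnorm x : e * `|x| <= f x.
  have [->|x0] := eqVneq x 0; first by rewrite normr0 mulr0.
  have nx : 0 < `|x| by rewrite normr_gt0.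
  have /ef : S (`|x|^-1 *: x).
    by rewrite /S /= normrZ ger0_norm ?invr_ge0// mulVf// gt_eqF.
  by rewrite fZ ?invr_ge0// mulrC ler_pdivlMr.
pose B := \sum_(k < m) Num.max 0 (s k 0).
exists (B / e); split; first exact: num_real.
move=> N BN x Px; apply: le_trans (ltW BN).
rewrite ler_pdivlMr// mulrC; apply: le_trans (fnorm x) _.
apply: ler_sum => k _; rewrite ge_max !le_max lexx /=.
by rewrite Px orbT.
Qed.

(** By compactness the maximum is attained, so [lp_value] is that maximum and not
    its default. *)
Lemma le_lp_value (R : realType) (m D : nat) (a : 'rV[R]_D)
    (A : 'M[R]_(m, D)) (b : 'cV[R]_m) (x : 'cV[R]_D) :
  compact (polyhedron A b) -> polyhedron A b x -> (a *m x) 0 0 <= lp_value a A b.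
Proof.
move=> Pcompact Px.
suff [v vmax] : exists v, is_max [set (a *m x) 0 0 | x in polyhedron A b] v.
  have [_ ub] := xgetPex 0 (ex_intro _ v vmax).
  by apply: ub; exists x.
have [] := compact_EVT_max (ex_intro _ x Px) Pcompact
  (f := fun x : 'cV[R]_D => (a *m x) 0 0).
  by apply: continuous_subspaceT => y; exact: mulmx_coord_continuous.
move=> c /set_mem Pc cmax; exists ((a *m c) 0 0); split; first by exists c.
by move=> _ [y Py <-]; apply: cmax; exact: mem_set.
Qed.

Theorem mainTheorem2 (R : realType) (N D : nat) (hN : (0 < N)%N)
    (hD : (0 < D)%N) (m : 'I_N -> nat)
    (A : forall i : 'I_N, 'M[R]_(m i, D)) (b : forall i : 'I_N, 'cV[R]_(m i))
    (hpoly : forall i : 'I_N, is_polytope (polyhedron (A i) (b i)))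
    (hne : forall i : 'I_N, polyhedron (A i) (b i) !=set0)
    (c : nat) (A' : 'M[R]_(c, D)) (hA' : lists_distinct_rows A A')
    (b' : 'I_N -> 'cV[R]_c)
    (hb' : forall (i : 'I_N) (j : 'I_c),
       b' i j 0 = lp_value (row j A') (A i) (b i)) :
  is_polytope (polyhedron A' (\sum_(i < N) b' i)) /\
  outer_approximation (polyhedron A' (\sum_(i < N) b' i))
    (minkowski_sum (fun i : 'I_N => polyhedron (A i) (b i))).
Proof.
have rowE p q (B : 'M[R]_(p, q)) (x : 'cV[R]_q) k :
    (B *m x) k 0 = (row k B *m x) 0 0 by rewrite -row_mul [RHS]mxE.
split.
  split; first by exists c, A', (\sum_(i < N) b' i).
  apply: polyhedron_compact => d A'd.
  have [_ Pcompact] := hpoly (Ordinal hN).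
  apply: (@bounded_polyhedron_recession _ _ _ _ _ d (hne (Ordinal hN))).
    exact: compact_bounded.
  (* every row of the first matrix is listed in A' *)
  move=> k; have [_ /(_ (row k (A (Ordinal hN))))[_ []]] := hA'.
    by exists (Ordinal hN), k.
  move=> j A'j; rewrite rowE -A'j -rowE [leRHS]mxE.
  by have := A'd j; rewrite [leRHS]mxE.
move=> _ [x Px <-] j.
rewrite mulmx_sumr !summxE; apply: ler_sum => i _.
rewrite hb' rowE; apply: le_lp_value; last exact: Px.
by have [] := hpoly i.
Qed.
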